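(* Let $\mu$ be an ergodic invariant probability measure for the skew product $\Theta(\omega,s)=(\theta(\omega),f(\omega,s))$ on $\Omega\times S^1$. Then for $\mu$-almost every $(\omega,s_0)$ the rotation number of the orbit $(s_n)$ starting at $s_0$, namely the limit $$OR_{(s_0)}=\lim_{n\to\infty}\frac{\gamma_n-\gamma_0}{n},$$ exists.
   Context: $(\Omega,\mathcal F,\mathbb P)$ is a probability space, $\theta:\Omega\to\Omega$ is a measure-preserving transformation that is ergodic with respect to $\mathbb P$, and $f:\Omega\times S^1\to S^1$ is a random variable with values in the space $\mathcal H^+$ of orientation-preserving homeomorphisms of $S^1$. Invariant probability measures of $\Theta$ are understood to have marginal $\mathbb P$ on $\Omega$. The covering map is $p:\mathbb R\to S^1$, $p(x)=e^{2\pi i x}$. For $\omega\in\Omega$ and $s_0\in S^1$ the random orbit is $s_n=f(\theta^{n-1}\omega,\cdot)\circ\cdots\circ f(\theta\omega,\cdot)\circ f(\omega,s_0)$. The angles $\gamma_n=\gamma_n(\omega,s_0)\in\mathbb R$ are defined as follows: $\gamma_0\in[0,1)$ with $p(\gamma_0)=s_0$, and inductively $\gamma_n$ is the unique real number with $p(\gamma_n)=s_n$ and $\gamma_{n-1}\le\gamma_n<\gamma_{n-1}+1$. *)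

(* Defs.v *)
From HB Require Import structures.
From mathcomp Require Import all_boot all_order all_algebra.
From mathcomp Require Import all_classical all_reals all_analysis.
From mathcomp Require Import ring lra.

Set Implicit Arguments.
Unset Strict Implicit.
Unset Printing Implicit Defensive.

Import Order.TTheory GRing.Theory Num.Theory.
Import numFieldNormedType.Exports.

Local Open Scope classical_set_scope.
Local Open Scope ring_scope.

Definition unit_circle (R : realType) : set (R * R) :=
  [set z | z.1 ^+ 2 + z.2 ^+ 2 = 1].

(* S^1 as a subspace of C = R^2, with the induced topology and uniformity. *)
Definition circle (R : realType) : Type := set_type (@unit_circle R).

HB.instance Definition _ (R : realType) := Uniform.on (circle R).

Lemma covering_subproof (R : realType) (x : R) :
  (cos (2 * pi * x), sin (2 * pi * x)) \in @unit_circle R.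
Proof. by apply/mem_set; rewrite /unit_circle /= cos2Dsin2. Qed.

(* The covering map p(x) = e^{2 pi i x}. *)
Definition covering (R : realType) (x : R) : circle R :=
  SigSub (covering_subproof x).

HB.instance Definition _ (R : realType) :=
  isPointed.Build (circle R) (covering 0).

(* The Borel sigma-algebra of S^1. *)
HB.instance Definition _ (R : realType) :=
  Measurable.copy (circle R) (g_sigma_algebraType (@open (circle R))).

Definition homeomorphism (T : topologicalType) (h : T -> T) : Prop :=
  continuous h /\
  exists g : T -> T, [/\ continuous g, cancel h g & cancel g h].

Definition orientation_preserving (R : realType) (h : circle R -> circle R) :
    Prop :=
  exists F : R -> R, [/\ continuous F, {homo F : x y / x < y} &
    forall x, covering (F x) = h (covering x)].

Definition orientation_preserving_homeos (R : realType) :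
    set {uniform circle R -> circle R} :=
  [set h | homeomorphism (h : circle R -> circle R) /\
           orientation_preserving h].

(* The space H^+ with the topology of uniform convergence. *)
Definition Hplus (R : realType) : Type :=
  set_type (@orientation_preserving_homeos R).

HB.instance Definition _ (R : realType) := Topological.on (Hplus R).

Definition Hplus_fun (R : realType) (h : Hplus R) : circle R -> circle R :=
  \val h.
Coercion Hplus_fun : Hplus >-> Funclass.

Lemma Hplus_id_subproof (R : realType) :
  (idfun : {uniform circle R -> circle R}) \in
  @orientation_preserving_homeos R.
Proof.
apply/mem_set; split.
  by split; [move=> x; exact: cvg_id | exists idfun; split => // x; exact: cvg_id].
by exists idfun; split => // x; exact: cvg_id.
Qed.

HB.instance Definition _ (R : realType) :=
  isPointed.Build (Hplus R) (SigSub (Hplus_id_subproof R)).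

(* The Borel sigma-algebra of H^+. *)
HB.instance Definition _ (R : realType) :=
  Measurable.copy (Hplus R) (g_sigma_algebraType (@open (Hplus R))).

Definition invariant_measure (R : realType) (d : measure_display)
    (T : measurableType d) (mu : probability T R) (g : T -> T) : Prop :=
  forall A, measurable A -> mu (g @^-1` A) = mu A.

Definition measure_preserving (R : realType) (d : measure_display)
    (T : measurableType d) (mu : probability T R) (g : T -> T) : Prop :=
  measurable_fun setT g /\ invariant_measure mu g.

Definition ergodic (R : realType) (d : measure_display)
    (T : measurableType d) (mu : probability T R) (g : T -> T) : Prop :=
  forall A, measurable A -> g @^-1` A = A -> mu A = 0%E \/ mu A = 1%E.

Section random_orbit.
Context (R : realType) (Omega : Type) (theta : Omega -> Omega).
Context (f : Omega -> Hplus R).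

Definition skew_product (x : Omega * circle R) : Omega * circle R :=
  (theta x.1, f x.1 x.2).

Fixpoint random_orbit (w : Omega) (s0 : circle R) (n : nat) : circle R :=
  if n is m.+1 then f (iter m theta w) (random_orbit w s0 m) else s0.

End random_orbit.

Section angles.
Context (R : realType).

(* The unique y with x <= y < x + 1 and p(y) = s; see next_angleP and
   next_angle_unique. *)
Definition next_angle (x : R) (s : circle R) : R :=
  xget 0 [set y | x <= y < x + 1 /\ covering y = s].

Fixpoint angle (s : nat -> circle R) (n : nat) : R :=
  if n is m.+1 then next_angle (angle s m) (s n) else next_angle 0 (s 0%N).

Lemma covering_surj (s : circle R) : exists y, covering y = s.
Proof.
case: s => -[a b] ab; have /= ab1 := set_mem ab; rewrite /unit_circle /= in ab1.
have a1 : -1 <= a <= 1 by nra.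
have key t : cos t = a -> sin t = b ->
    exists y : R, covering y = SigSub ab.
  move=> ct st; exists (t / (2 * pi)); apply: val_inj => /=.
  have -> : 2 * pi * (t / (2 * pi)) = t :> R.
    by rewrite mulrC divfK// mulf_neq0// gt_eqF// pi_gt0.
  by rewrite ct st.
have ca : cos (acos a) = a by rewrite acosK// in_itv.
have sa : sin (acos a) = `|b|.
  rewrite sin_acos// -sqrtr_sqr; congr Num.sqrt.
  by rewrite -ab1; ring.
have [b0|b0] := leP 0 b.
  by apply: (key (acos a)) => //; rewrite sa ger0_norm.
by apply: (key (- acos a)); rewrite ?cosN ?sinN// sa ltr0_norm// opprK.
Qed.

Lemma covering_periodic (y : R) (k : int) : covering (y + k%:~R) = covering y.
Proof.
have aux n z : covering (z + n%:R : R) = covering z.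
  apply: val_inj => /=.
  have -> : 2 * pi * (z + n%:R) = 2 * pi * z + (pi *+ 2) *+ n.
    by rewrite -(mulr_natr (pi *+ 2)); ring.
  by rewrite (periodicn (@cosD2pi R)) (periodicn (@sinD2pi R)).
case: k => n; first exact: aux.
by rewrite -[RHS]/(covering y) -(aux n.+1 (y + _)) NegzE mulrNz addrNK.
Qed.

Lemma covering_inj (x y z : R) : x <= y < x + 1 -> x <= z < x + 1 ->
  covering y = covering z -> y = z.
Proof.
wlog yz : y z / y <= z.
  move=> W hy hz e; have [yz|/ltW zy] := leP y z; first exact: W.
  by apply/esym/W.
move=> /andP[xy _] /andP[_ zx] /(congr1 val) /= [ec es].
have c1 : cos (2 * pi * (z - y)) = 1 :> R.
  by rewrite mulrBr cosB ec es -!expr2 cos2Dsin2.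
have p0 := pi_gt0 R.
have d1 : z - y < 1 by lra.
have [h|h] := leP (2 * (z - y)) 1.
  have : 2 * pi * (z - y) = 0.
    apply: (@cos_inj R); rewrite ?in_itv /= ?cos0//; nra.
  move=> /eqP; rewrite mulf_eq0 gt_eqF ?mulr_gt0//= subr_eq0 => /eqP.
  by [].
have : pi *+ 2 - 2 * pi * (z - y) = 0.
  apply: (@cos_inj R); rewrite ?in_itv /= ?cos0//; [nra|nra|].
  by rewrite cosB cos2pi sin2pi c1; ring.
nra.
Qed.

Lemma next_angleP (x : R) (s : circle R) :
  x <= next_angle x s < x + 1 /\ covering (next_angle x s) = s.
Proof.
suff h : exists y, x <= y < x + 1 /\ covering y = s by exact: xgetPex h.
have [y <-] := covering_surj s.
exists (y + (- Num.floor (y - x))%:~R); split; last exact: covering_periodic.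
have := Num.Theory.floor_itv (y - x); rewrite intrD mulrNz; lra.
Qed.

Lemma next_angle_unique (x : R) (s : circle R) (y : R) :
  x <= y < x + 1 -> covering y = s -> y = next_angle x s.
Proof.
have [h1 h2] := next_angleP x s => h3 h4.
by apply: (covering_inj h3 h1); rewrite h2.
Qed.

End angles.

(* Main.v *)
(* The increment gamma_(n+1) - gamma_n depends only on (s_n, s_(n+1)), hence is
   phi(Theta^n(w, s_0)) for a measurable phi with values in [0, 1). So
   (gamma_n - gamma_0) / n is a Birkhoff average of phi for the ergodic system
   (Theta, mu), and converges almost everywhere to the integral of phi.

   The ergodic theorem for bounded phi: if psi := phi - c has negative integral,
   the invariant set where the Birkhoff sums of psi are unbounded above cannot
   have full measure, by an integrated form of the maximal inequality; so it is
   null, i.e. S_n phi <= n c + O(1) almost everywhere. Apply this to phi and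
   - phi, with c running through a sequence. *)

Require Import Defs.
From HB Require Import structures.
From mathcomp Require Import all_boot all_order all_algebra.
From mathcomp Require Import all_classical all_reals all_analysis.
From mathcomp Require Import measurable_realfun ring lra.

Set Implicit Arguments.
Unset Strict Implicit.
Unset Printing Implicit Defensive.

Import Order.TTheory GRing.Theory Num.Theory.
Import numFieldNormedType.Exports.

Local Open Scope classical_set_scope.
Local Open Scope ring_scope.

(** * The ergodic theorem for bounded functions *)

Section birkhoff.
Context (R : realType) (d : measure_display) (T : measurableType d).
Context (mu : probability T R) (g : T -> T).

Definition birkhoff_sum (phi : T -> R) (n : nat) (x : T) : R :=
  \sum_(i < n) phi (iter i g x).

(* The maximum over k <= n of the Birkhoff sums S_k, with S_0 = 0. *)
Fixpoint birkhoff_max (phi : T -> R) (n : nat) (x : T) : R :=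
  if n is m.+1 then Num.max 0 (phi x + birkhoff_max phi m (g x)) else 0.

Lemma birkhoff_sumS phi n x :
  birkhoff_sum phi n.+1 x = phi x + birkhoff_sum phi n (g x).
Proof.
rewrite /birkhoff_sum big_ord_recl /=; congr (_ + _).
by apply: eq_bigr => i _; congr phi; exact: iterSr.
Qed.

Lemma birkhoff_max_ge0 phi n x : 0 <= birkhoff_max phi n x.
Proof. by case: n => //= n; rewrite le_max lexx. Qed.

Lemma birkhoff_sum_le_max phi n x : birkhoff_sum phi n x <= birkhoff_max phi n x.
Proof.
elim: n x => [|n IH] x; first by rewrite /birkhoff_sum big_ord0.
by rewrite birkhoff_sumS /= le_max lerD2l IH orbT.
Qed.

Lemma birkhoff_max_leS phi n x :
  birkhoff_max phi n x <= birkhoff_max phi n.+1 x.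
Proof.
elim: n x => [|n IH] x; first exact: birkhoff_max_ge0.
by rewrite /= ge_max le_max lexx /= le_max lerD2l IH orbT.
Qed.

Lemma birkhoff_max_le phi m n x : (m <= n)%N ->
  birkhoff_max phi m x <= birkhoff_max phi n x.
Proof.
move=> /subnK <-; elim: (n - m)%N => // k IH.
by rewrite addSn (le_trans IH)// birkhoff_max_leS.
Qed.

Lemma birkhoff_max_bound phi C n x : (forall y, `|phi y| <= C) ->
  birkhoff_max phi n x <= n%:R * C.
Proof.
move=> hC; elim: n x => [|n IH] x; first by rewrite mul0r.
have C0 : 0 <= C := le_trans (normr_ge0 _) (hC x).
rewrite /= ge_max mulr_ge0//= -natr1 mulrDl mul1r addrC lerD//.
by rewrite (le_trans (ler_norm _)).
Qed.

Lemma measurable_birkhoff_max phi n : measurable_fun setT g ->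
  measurable_fun setT phi -> measurable_fun setT (birkhoff_max phi n).
Proof.
move=> mg mphi; elim: n => [|n IH] /=; first exact: measurable_cst.
apply: measurable_maxr; first exact: measurable_cst.
by apply: measurable_funD => //; exact: measurableT_comp.
Qed.

(** Invariance identifies [mu] with its pushforward under [g]; the rest is the change of variables
    formula. *)
Lemma integral_invariant (h : T -> \bar R) : measure_preserving mu g ->
  measurable_fun setT h -> (forall x, (0 <= h x)%E) ->
  (\int[mu]_x h (g x) = \int[mu]_x h x)%E.
Proof.
move=> [mg inv] mh h0.
have := ge0_integral_pushforward mg mu measurableT mh (fun y _ => h0 y).
rewrite preimage_setT => <-.
by apply: eq_measure_integral => A mA _; exact: inv.
Qed.

Lemma bounded_integrable (h : T -> R) C : measurable_fun setT h ->
  (forall x, `|h x| <= C) -> mu.-integrable setT (EFin \o h).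
Proof.
move=> mh hC; apply: measurable_bounded_integrable => //.
  by rewrite (le_lt_trans (probability_le1 _ _)) ?ltry.
by exists C; split => [|M CM x _ /=]; rewrite ?num_real// (le_trans (hC x))// ltW.
Qed.

(** Since the maxima run over [S_0 = 0, ..., S_n], they are unbounded exactly when the sums are
    unbounded above. *)
Definition birkhoff_unbounded (phi : T -> R) : set T :=
  [set x | forall k, exists n, k%:R < birkhoff_max phi n x].

Lemma measurable_birkhoff_unbounded phi : measurable_fun setT g ->
  measurable_fun setT phi -> measurable (birkhoff_unbounded phi).
Proof.
move=> mg mphi.
have -> : birkhoff_unbounded phi =
    \bigcap_k \bigcup_n (birkhoff_max phi n @^-1` `]k%:R, +oo[%classic).
  apply/seteqP; split => x /= h k; have := h k.
    by move=> [n hn] _; exists n => //=; rewrite in_itv /= andbT.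
  by move=> /(_ I) [n _ /=]; rewrite in_itv /= andbT => hn; exists n.
apply: bigcapT_measurable => k; apply: bigcupT_measurable => n.
rewrite -[X in measurable X]setTI.
by apply: measurable_birkhoff_max => //; exact: measurable_itv.
Qed.

(** The maxima satisfy [M_(n+1)(x) = max(0, phi x + M_n(g x))], so raising the threshold by a
    natural number above [|phi x|] carries unboundedness from [g x] to [x] and back. *)
Lemma birkhoff_unbounded_invariant phi :
  g @^-1` birkhoff_unbounded phi = birkhoff_unbounded phi.
Proof.
have phi_lt x : `|phi x| < (Num.bound `|phi x|)%:R by exact: archi_boundP.
apply/seteqP; split => x h k;
    have k0 : 0 <= k%:R :> R by []; have b0 := normr_ge0 (phi x);
    have [[|n]] := h (k + Num.bound `|phi x|)%N; have := phi_lt x;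
    rewrite natrD => /ltr_normlP[p1 p2] hn.
- by move: hn => /=; lra.
- exists n.+2; move: hn; set M := birkhoff_max phi n.+1 (g x) => hn.
  by rewrite -[birkhoff_max _ _ _]/(Num.max 0 (phi x + M)) lt_max; lra.
- by move: hn => /=; lra.
- by exists n; move: hn; rewrite /= lt_max; lra.
Qed.

(* The limit in n of the identity
   birkhoff_max n.+1 - birkhoff_max n o g = max(- birkhoff_max n o g, phi),
   whose left-hand side has nonnegative integral. *)
Lemma birkhoff_unbounded_null (phi : T -> R) (C : R) : measure_preserving mu g ->
  ergodic mu g -> measurable_fun setT phi -> (forall x, `|phi x| <= C) ->
  (\int[mu]_x (phi x)%:E < 0)%E -> mu (birkhoff_unbounded phi) = 0%E.
Proof.
move=> mpg erg mphi phiC int_lt0; have mg := mpg.1.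
have mE := measurable_birkhoff_unbounded mg mphi.
have [//|E1] := erg _ mE (birkhoff_unbounded_invariant phi).
have aeE : {ae mu, forall x, birkhoff_unbounded phi x}.
  exists (~` birkhoff_unbounded phi); split => //; first exact: measurableC.
  by rewrite probability_setC// E1 subee.
pose M n := birkhoff_max phi n.
have mM n : measurable_fun setT (M n) by exact: measurable_birkhoff_max.
have mMg n : measurable_fun setT (M n \o g) by exact: measurableT_comp.
have MC n x : `|M n x| <= n%:R * C.
  by rewrite ger0_norm ?birkhoff_max_ge0//; exact: birkhoff_max_bound.
have iM n : mu.-integrable setT (EFin \o M n) by exact: bounded_integrable (MC n).
have iMg n : mu.-integrable setT (EFin \o (M n \o g)).
  by apply: (@bounded_integrable _ (n%:R * C)) => // x; exact: MC.
pose F n x := Num.max (- M n (g x)) (phi x).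
have mF n : measurable_fun setT (F n).
  apply: measurable_maxr => //.
  exact: measurableT_comp (mMg n).
have F_ge0 n : (0 <= \int[mu]_x (F n x)%:E)%E.
  have -> : (\int[mu]_x (F n x)%:E =
      \int[mu]_x ((EFin \o M n.+1) \- (EFin \o (M n \o g))) x)%E.
    apply: eq_integral => x _ /=; rewrite -EFinB; congr EFin.
    by rewrite /F /M /= addr_maxl add0r addrK.
  rewrite integralB// sube_ge0; last by rewrite integrable_fin_num.
  rewrite (integral_invariant mpg (h := EFin \o M n)); first last.
  - by move=> x; rewrite lee_fin birkhoff_max_ge0.
  - exact/measurable_EFinP.
  by apply: le_integral => // x _; rewrite lee_fin birkhoff_max_leS.
have [||||| _ _ cF] := @dominated_convergence _ _ _ mu setT measurableT
    (fun n => EFin \o F n) (EFin \o phi) (EFin \o cst C).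
- by move=> n; exact/measurable_EFinP.
- exact/measurable_EFinP.
(* On the unbounded set the maxima at [g x] eventually exceed [- phi x]; from then on [F n x] equals
   [phi x]. *)
- apply: filterS aeE => x Ex _.
  have [n hn] : exists n, - phi x < M n (g x).
    have : (g @^-1` birkhoff_unbounded phi) x.
      by rewrite birkhoff_unbounded_invariant.
    move=> /(_ (Num.bound `|phi x|)) [n hn]; exists n; apply: le_lt_trans hn.
    by rewrite (le_trans (ler_norm _))// normrN ltW// archi_boundP.
  apply: cvg_near_cst; exists n => //= k nk; rewrite /F max_r//.
  by rewrite lerNl (le_trans (ltW hn))// birkhoff_max_le.
- by apply: (@bounded_integrable _ `|C|) => // x.
(* The maxima are nonnegative, so [F n x] lies between [phi x] and [max(0, phi x)]. *)
- apply: aeW => x n _ /=; rewrite lee_fin /F.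
  have := birkhoff_max_ge0 phi n (g x); have := phiC x.
  rewrite -/(M n (g x)) !ler_norml /Num.max; case: ifP; lra.
suff : (0 <= \int[mu]_x (phi x)%:E)%E by rewrite leNgt int_lt0.
have /cvg_lim <- // := cF.
apply: lime_ge; first by apply/cvg_ex; eexists; exact: cF.
exact: nearW.
Qed.

(** The function [phi - c] has negative integral, so off a null set its Birkhoff sums
    [S_n phi - n c] are bounded above. *)
Lemma birkhoff_sum_upper (phi : T -> R) (C c : R) : measure_preserving mu g ->
  ergodic mu g -> measurable_fun setT phi -> (forall x, `|phi x| <= C) ->
  (\int[mu]_x (phi x)%:E < c%:E)%E ->
  {ae mu, forall x, exists K : R, forall n, birkhoff_sum phi n x <= n%:R * c + K}.
Proof.
move=> mpg erg mphi phiC intc; pose psi x := phi x - c.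
have mpsi : measurable_fun setT psi by exact: measurable_funB.
have psiC x : `|psi x| <= C + `|c|.
  by rewrite (le_trans (ler_normB _ _))// lerD.
have null : mu (birkhoff_unbounded psi) = 0%E.
  apply: (birkhoff_unbounded_null mpg erg mpsi psiC).
  under eq_integral do rewrite EFinB.
  rewrite integralB_EFin//; last 2 first.
  - exact: (@bounded_integrable _ C).
  - by apply: (@bounded_integrable _ `|c|) => // x.
  rewrite integral_cst// [X in (_ * X)%E]probability_setT mule1.
  by rewrite sube_lt0// orbT.
exists (birkhoff_unbounded psi); split => //.
  by apply: measurable_birkhoff_unbounded => //; exact: mpg.1.
move=> x /=; apply: contra_notP => /existsNP[k /forallNP hk].
exists k%:R => n.
have := birkhoff_sum_le_max psi n x.
have : birkhoff_max psi n x <= k%:R by rewrite leNgt; apply/negP; exact: hk.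
rewrite /birkhoff_sum big_split /= sumrN sumr_const card_ord.
rewrite -mulr_natl; lra.
Qed.

Theorem birkhoff_ergodic (phi : T -> R) (C : R) : measure_preserving mu g ->
  ergodic mu g -> measurable_fun setT phi -> (forall x, `|phi x| <= C) ->
  {ae mu, forall x,
    birkhoff_sum phi n x / n%:R @[n --> \oo] --> \int[mu]_x phi x}.
Proof.
move=> mpg erg mphi phiC; set a := \int[mu]_x phi x.
have iphi : mu.-integrable setT (EFin \o phi) by exact: bounded_integrable phiC.
have intE : (\int[mu]_x (phi x)%:E = a%:E)%E.
  by rewrite fineK//; exact: integrable_fin_num.
have up k : {ae mu, forall x, exists K : R, forall n,
    birkhoff_sum phi n x <= n%:R * (a + k.+1%:R^-1) + K}.
  apply: (@birkhoff_sum_upper _ C) => //.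
  by rewrite intE lte_fin ltrDl invr_gt0.
have lo k : {ae mu, forall x, exists K : R, forall n,
    birkhoff_sum (\- phi) n x <= n%:R * (- a + k.+1%:R^-1) + K}.
  apply: (@birkhoff_sum_upper _ C) => //.
  - exact: measurableT_comp.
  - by move=> x; rewrite normrN.
  under eq_integral do rewrite EFinN.
  rewrite integralN; last exact: integrable_add_def.
  by rewrite intE lte_fin ltrDl invr_gt0.
(* Slopes indexed by [k : nat] keep the exceptional set a countable union of null sets. *)
have := ae_foralln lo; have := ae_foralln up.
apply: filterS2 => x hup hlo.
apply/cvgrPdist_le => e e0.
(* The error [e] is halved: [1 / (k + 1)] stays below [e / 2], and for large [n] the constants [K1]
   and [K2], divided by [n], cost at most [e / 2]. *)
have [k] := ltr_add_invr (divr_gt0 e0 (ltr0Sn R 1)); rewrite add0r => ke.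
have [K1 h1] := hup k; have [K2 h2] := hlo k.
near=> n.
have n0 : 0 < n%:R :> R by rewrite ltr0n; near: n; exact: nbhs_infty_gt.
have nK : (`|K1| + `|K2|) / (e / 2) <= n%:R.
  by near: n; exact: nbhs_infty_ger.
move: nK; rewrite ler_pdivrMr ?divr_gt0// => nK.
have -> : a - birkhoff_sum phi n x / n%:R =
    (n%:R * a - birkhoff_sum phi n x) / n%:R by field; rewrite gt_eqF.
rewrite normrM [X in _ * X]gtr0_norm ?invr_gt0// ler_pdivrMr//.
have := h1 n; have := h2 n; rewrite /birkhoff_sum /= sumrN.
have : n%:R * k.+1%:R^-1 <= n%:R * (e / 2) by rewrite ler_pM2l// ltW.
have := ler_norm K1; have := ler_norm K2.
have := normr_ge0 K1; have := normr_ge0 K2.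
have -> : e * n%:R = n%:R * (e / 2) + n%:R * (e / 2) by field.
move: nK; rewrite ler_norml !mulrDr mulrN -/(birkhoff_sum phi n x).
by move: (n%:R * a) (n%:R / _) (n%:R * (e / 2)) => u v w; lra.
Unshelve. all: by end_near.
Qed.

End birkhoff.

(** * Measurability of the angular displacement *)

Section circle.
Context (R : realType).
Implicit Types (s t z : circle R) (x y : R).

Definition arg s : R := next_angle 0 s.

Definition re s : R := (\val s).1.
Definition im s : R := (\val s).2.

Lemma re_im s : re s ^+ 2 + im s ^+ 2 = 1.
Proof. by case: s => -[a b] ab; exact: set_mem ab. Qed.

Lemma argK s : covering (arg s) = s.
Proof. by have [] := next_angleP 0 s. Qed.

Lemma arg_bounds s : 0 <= arg s < 1.
Proof. by have [] := next_angleP 0 s; rewrite add0r. Qed.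

Lemma next_angleD_int x (k : int) s :
  next_angle (x + k%:~R) s = next_angle x s + k%:~R.
Proof.
have [xs e] := next_angleP x s; apply/esym/next_angle_unique; first lra.
by rewrite covering_periodic.
Qed.

(** Some integer translate of [y] falls in [[x, x + 1)], where [covering] is injective. *)
Lemma covering_eq x y :
  covering x = covering y -> exists k : int, x = y + k%:~R.
Proof.
move=> e; exists (- Num.floor (y - x)); apply: (@covering_inj R x).
- lra.
- by have := Num.Theory.floor_itv (y - x); rewrite intrD mulrNz; lra.
- by rewrite covering_periodic.
Qed.

Definition displacement s t : R := next_angle (arg s) t - arg s.

(** The increment is independent of the lift [x]: two lifts differ by an integer, and [next_angle]
    commutes with integer translations. *)
Lemma displacementE x t : next_angle x t - x = displacement (covering x) t.
Proof.
have [k {1 2}->] := covering_eq (esym (argK (covering x))).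
by rewrite next_angleD_int /displacement; ring.
Qed.

Lemma displacement_bounds s t : 0 <= displacement s t < 1.
Proof. by have [] := next_angleP (arg s) t; rewrite /displacement; lra. Qed.

(** Both arguments lie in [[0, 1)], so the first lift of [t] from [arg s] on is [arg t], or
    [arg t + 1] if [arg t] comes before [arg s]. *)
Lemma displacement_arg s t :
  displacement s t = arg t - arg s + (arg t < arg s)%R%:R.
Proof.
have := arg_bounds s; have := arg_bounds t => hs ht.
rewrite /displacement; case: ltP => h.
  have <- : arg t + (1 : int)%:~R = next_angle (arg s) t.
    by apply: next_angle_unique; rewrite ?covering_periodic ?argK//; lra.
  by rewrite mulr1z /=; lra.
have <- : arg t = next_angle (arg s) t; last by rewrite /=; lra.
by apply: next_angle_unique; rewrite ?argK//; lra.
Qed.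

(** This gives the measurability of [arg], which jumps at the point [covering 0]. On the closed
    upper half circle the angle is [acos (re s)]; the lower half is its mirror image. *)
Lemma arg_acos s : arg s =
  if 0 <= im s then acos (re s) / (2 * pi) else 1 - acos (re s) / (2 * pi).
Proof.
have reb : -1 <= re s <= 1 by have := re_im s; nra.
have pi0 := pi_gt0 R.
have sinE : sin (acos (re s)) = `|im s|.
  rewrite sin_acos// -sqrtr_sqr; congr Num.sqrt.
  by rewrite -(re_im s); ring.
have cosE : cos (acos (re s)) = re s by rewrite acosK// in_itv.
have acosE : 2 * pi * (acos (re s) / (2 * pi)) = acos (re s).
  by rewrite mulrC divfK// mulf_neq0// gt_eqF.
have a0 : 0 <= acos (re s) / (2 * pi).
  by rewrite divr_ge0 ?acos_ge0//; lra.
have a1 : acos (re s) / (2 * pi) <= 1 / 2.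
  by rewrite ler_pdivrMr ?mulr_gt0//; have := acos_lepi reb; lra.
apply/esym; case: ifPn => [s0|]; [|rewrite -ltNge => s0].
  apply: next_angle_unique; first lra.
  apply: val_inj => /=; rewrite acosE cosE sinE ger0_norm//.
  by rewrite -surjective_pairing.
apply: next_angle_unique.
  (* The candidate must stay strictly below 1; a vanishing [acos (re s)] would force [im s = 0]. *)
  suff : acos (re s) / (2 * pi) != 0 by rewrite neq_lt ltNge a0 /=; lra.
  apply/eqP => z; move: sinE; rewrite -acosE z mulr0 sin0 ltr0_norm//; lra.
rewrite addrC -[1]/((1 : int)%:~R) covering_periodic; apply: val_inj => /=.
rewrite mulrN acosE cosN sinN cosE sinE ltr0_norm// opprK.
by rewrite -surjective_pairing.
Qed.


(** * Continuity and Borel measurability on the circle and on [Hplus] *)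

Lemma continuous_re : continuous re.
Proof.
move=> s; apply: (@continuous_comp _ _ _ (fun s : circle R => \val s) fst);
  last exact: cvg_fst.
exact: initial_continuous.
Qed.

Lemma continuous_im : continuous im.
Proof.
move=> s; apply: (@continuous_comp _ _ _ (fun s : circle R => \val s) snd);
  last exact: cvg_snd.
exact: initial_continuous.
Qed.

Lemma continuous_covering : continuous (@covering R).
Proof.
apply: (@continuous_comp_initial _ _ _ (@set_val _ (@unit_circle R))
  (@covering R)) => x.
have cl : {for x, continuous (fun y : R => 2 * pi * y)}.
  exact: mulrl_continuous.
have cc := continuous_comp cl (@continuous_cos R _).
have cs := continuous_comp cl (@continuous_sin R _).
exact: (cvg_pair cc cs).
Qed.

(** Uniform convergence implies pointwise convergence: an entourage [E] at [h s] also defines a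
    uniform neighbourhood of [h]. *)
Lemma continuous_eval s : continuous (fun h : Hplus R => h s : circle R).
Proof.
move=> h W /nbhsP[E entE EW].
have vc : {for h, continuous
    (fun k : Hplus R => \val k : {uniform circle R -> circle R})}.
  exact: initial_continuous.
suff : nbhs (\val h : {uniform circle R -> circle R}) [set k | W (k s)].
  by move/vc.
apply/uniform_nbhs; exists E; split => // k hk.
by apply: EW; apply/xsectionP; exact: hk.
Qed.

Lemma continuous_measurable_circle (h : circle R -> R) :
  continuous h -> measurable_fun setT h.
Proof.
move=> /continuousP ch; apply: (measurability _ (RGenOpens.measurableE R)).
move=> _ [_ [a [b ->]] <-]; rewrite setTI; apply: sub_sigma_algebra.
by apply: ch; exact: interval_open.
Qed.

Lemma measurable_covering : measurable_fun setT (@covering R).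
Proof.
apply: (measurability (@open (circle R))) => // _ [U oU <-].
rewrite setTI; apply: open_measurable.
by move/continuousP: continuous_covering; exact.
Qed.

Lemma measurable_eval s :
  measurable_fun setT (fun h : Hplus R => h s : circle R).
Proof.
apply: (measurability (@open (circle R))) => // _ [U oU <-].
rewrite setTI; apply: sub_sigma_algebra.
by move/continuousP: (continuous_eval (s := s)); exact.
Qed.

(** As [acos] is decreasing on [[-1, 1]], [c <= acos (u w)] means [u w <= cos c] when [0 < c <= pi];
    for other [c] the preimage of the ray is everything or empty. *)
Lemma measurable_acos d (T : measurableType d) (u : T -> R) :
  measurable_fun setT u -> (forall w, -1 <= u w <= 1) ->
  measurable_fun setT (fun w => acos (u w)).
Proof.
move=> mu u1; apply: (measurability _ (RGenCInfty.measurableE R)).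
move=> _ [_ [c ->] <-]; rewrite setTI.
have [c0|c0] := leP c 0.
  rewrite (_ : _ @^-1` _ = setT); first exact: measurableT.
  apply/seteqP; split => // w _ /=; rewrite in_itv /= andbT.
  by rewrite (le_trans c0)// acos_ge0.
have [cpi|cpi] := ltP pi c.
  rewrite (_ : _ @^-1` _ = set0); first exact: measurable0.
  apply/seteqP; split => // w /=; rewrite in_itv /= andbT.
  by have := acos_lepi (u1 w); lra.
rewrite (_ : _ @^-1` _ = u @^-1` `]-oo, cos c]).
  by rewrite -[X in measurable X]setTI; apply: mu.
have cosE w : (u w <= cos c) = (c <= acos (u w)).
  have uw : acos (u w) \in `[0, pi] by rewrite in_itv /= acos_ge0 ?acos_lepi.
  have cw : c \in `[0, pi] by rewrite in_itv /= cpi ltW.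
  have {1}<- : cos (acos (u w)) = u w by rewrite acosK// in_itv /= u1.
  by rewrite !leNgt ltr_cos.
by apply/seteqP; split => w /=; rewrite !in_itv /= ?andbT cosE.
Qed.

(** Only the coordinates of [h] are assumed measurable, because [measurable_fun_circle] deduces the
    measurability of [h] from this. *)
Lemma measurable_arg d (T : measurableType d) (h : T -> circle R) :
  measurable_fun setT (re \o h) -> measurable_fun setT (im \o h) ->
  measurable_fun setT (arg \o h).
Proof.
move=> mre mim.
rewrite (_ : arg \o h = fun w => if 0 <= im (h w)
    then acos (re (h w)) / (2 * pi) else 1 - acos (re (h w)) / (2 * pi));
    last first.
  by apply/funext => w /=; rewrite arg_acos.
have macos : measurable_fun setT (fun w => acos (re (h w)) / (2 * pi)).
  apply: measurable_funM => //; apply: measurable_acos => // w.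
  by have := re_im (h w); nra.
apply: measurable_fun_ifT => //.
- exact: measurable_fun_ler.
- exact: measurable_funB.
Qed.

(** The map factors as [covering] after [arg \o h], which reduces the question to real-valued
    functions. *)
Lemma measurable_fun_circle d (T : measurableType d) (h : T -> circle R) :
  measurable_fun setT (re \o h) -> measurable_fun setT (im \o h) ->
  measurable_fun setT h.
Proof.
move=> mre mim; rewrite (_ : h = @covering R \o (arg \o h)); last first.
  by apply/funext => w /=; rewrite argK.
by apply: measurableT_comp; [exact: measurable_covering|exact: measurable_arg].
Qed.

Definition grid_point (n : nat) s : circle R :=
  covering ((Num.truncn (n%:R * arg s))%:R / n%:R).

(** Rounding down moves [arg s] by at most [1 / (n + 1)], and [covering] is continuous. *)
Lemma cvg_grid_point s : grid_point n.+1 s @[n --> \oo] --> s.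
Proof.
rewrite -[X in _ --> X]argK; apply: continuous_cvg.
  exact: continuous_covering.
apply/cvgrPdist_le => e e0; near=> n.
have n0 : 0 < n.+1%:R :> R by rewrite ltr0n.
have /andP[a0 _] := arg_bounds s.
have := Num.Theory.truncn_itv (mulr_ge0 (ltW n0) a0).
set k := Num.truncn _; rewrite -[k.+1%:R]natr1 => /andP[h1 h2].
have -> : arg s - k%:R / n.+1%:R = (n.+1%:R * arg s - k%:R) / n.+1%:R.
  by field; rewrite gt_eqF.
rewrite ger0_norm ?divr_ge0 ?subr_ge0//.
apply: (@le_trans _ _ n.+1%:R^-1).
  by rewrite ler_pdivrMr// mulVf ?gt_eqF//; lra.
by rewrite ltW//; near: n; exact: near_infty_natSinv_lt (PosNum e0).
Unshelve. all: by end_near.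
Qed.

End circle.

(** A preimage is a countable union of pieces on which the index [k] is constant. With [k] a grid
    index, this freezes the point where [f w] is evaluated. *)
Lemma measurable_fun_glue d d' (T : measurableType d) (U : measurableType d')
    (k : T -> nat) (h : nat -> T -> U) :
  (forall j, measurable (k @^-1` [set j])) ->
  (forall j, measurable_fun setT (h j)) ->
  measurable_fun setT (fun x => h (k x) x).
Proof.
move=> mk mh _ Y mY; rewrite setTI.
have -> : (fun x => h (k x) x) @^-1` Y =
    \bigcup_j (k @^-1` [set j] `&` h j @^-1` Y).
  apply/seteqP; split => [x Yx|x [j _ [/= <-]]//].
  by exists (k x).
apply: bigcupT_measurable => j; apply: measurableI => //.
by rewrite -[X in measurable X]setTI; exact: mh.
Qed.

(** * Measurability of the skew product, and angles as Birkhoff sums *)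

Section skew_product.
Context (R : realType) (d : measure_display) (Omega : measurableType d).
Context (theta : Omega -> Omega) (f : Omega -> Hplus R).
Context (theta_measurable : measurable_fun setT theta).
Context (f_measurable : measurable_fun setT f).

(* f is a Caratheodory function: it is the pointwise limit of
   (w, s) |-> f w (grid_point n s), and grid_point n takes countably many
   values. *)
Lemma measurable_fun_eval :
  measurable_fun setT (fun x : Omega * circle R => f x.1 x.2 : circle R).
Proof.
(* Composing with a continuous real function [c], later [re] and [im], allows passing to pointwise
   limits of real-valued measurable functions. *)
suff mc (c : circle R -> R) : continuous c ->
    measurable_fun setT (fun x : Omega * circle R => c (f x.1 x.2)).
  apply: measurable_fun_circle; apply: mc;
    [exact: continuous_re|exact: continuous_im].
move=> cc; pose h n (x : Omega * circle R) := c (f x.1 (grid_point n.+1 x.2)).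
apply: (@measurable_fun_cvg _ _ _ _ h) => [n|x _].
  apply: measurableT_comp; first exact: continuous_measurable_circle.
  pose k (x : Omega * circle R) := Num.truncn (n.+1%:R * arg x.2).
  apply: (measurable_fun_glue (k := k)
    (h := fun j x => f x.1 (covering (j%:R / n.+1%:R)))) => j.
    rewrite (_ : k @^-1` _ =
      (fun x => n.+1%:R * arg x.2) @^-1` `[j%:R, j.+1%:R[); last first.
      have a0 (x : Omega * circle R) : 0 <= n.+1%:R * arg x.2.
        by have /andP[? _] := arg_bounds x.2; rewrite mulr_ge0.
      apply/seteqP; split => x /=; rewrite in_itv /= -Num.Theory.truncn_eq//;
        by move/eqP.
    rewrite -[X in measurable X]setTI.
    suff : measurable_fun setT (fun x : Omega * circle R => n.+1%:R * arg x.2).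
      by apply => //; exact: measurable_itv.
    apply: measurable_funM => //.
    apply: (measurable_arg (h := snd));
      (apply: measurableT_comp; last exact: measurable_snd);
      apply: continuous_measurable_circle;
      [exact: continuous_re|exact: continuous_im].
  apply: (measurableT_comp (measurable_eval (covering (j%:R / n.+1%:R)))).
  exact: measurableT_comp.
apply: continuous_cvg; first exact: cc.
apply: continuous_cvg; last exact: cvg_grid_point.
by have [[fc _] _] := set_mem (valP (f x.1)); exact: fc.
Qed.

Lemma measurable_skew_product : measurable_fun setT (skew_product theta f).
Proof.
apply: measurable_fun_pair; last exact: measurable_fun_eval.
exact: measurableT_comp.
Qed.

(** This is the observable whose Birkhoff averages are the quotients [(gamma_n - gamma_0) / n]. *)
Definition orbit_displacement (x : Omega * circle R) : R :=
  displacement x.2 (f x.1 x.2).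

Lemma measurable_orbit_displacement : measurable_fun setT orbit_displacement.
Proof.
rewrite (_ : orbit_displacement = fun x : Omega * circle R =>
    if (arg (f x.1 x.2) < arg x.2)%R then arg (f x.1 x.2) - arg x.2 + 1
    else arg (f x.1 x.2) - arg x.2); last first.
  apply/funext => x; rewrite /orbit_displacement displacement_arg.
  by case: ifP; rewrite ?addr0.
have marg : measurable_fun setT (@arg R).
  apply: (measurable_arg (h := idfun)).
    exact: continuous_measurable_circle (@continuous_re R).
  exact: continuous_measurable_circle (@continuous_im R).
have m1 : measurable_fun setT (fun x : Omega * circle R => arg (f x.1 x.2)).
  exact: measurableT_comp marg measurable_fun_eval.
have m2 : measurable_fun setT (fun x : Omega * circle R => arg x.2).
  exact: measurableT_comp marg measurable_snd.
apply: measurable_fun_ifT; first exact: measurable_fun_ltr.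
- by apply: measurable_funD => //; exact: measurable_funB.
- exact: measurable_funB.
Qed.

Lemma iter_skew_product n x :
  iter n (skew_product theta f) x =
  (iter n theta x.1, random_orbit theta f x.1 x.2 n).
Proof. by elim: n => [|n /= ->//]; case: x. Qed.

Lemma covering_angle (s : nat -> circle R) n : covering (angle s n) = s n.
Proof. by case: n => [|n]; exact: (next_angleP _ _).2. Qed.

Lemma angle_birkhoff_sum x n :
  let gamma := angle (random_orbit theta f x.1 x.2) in
  gamma n - gamma 0%N =
  birkhoff_sum (skew_product theta f) orbit_displacement n x.
Proof.
move=> gamma; elim: n => [|n IH]; first by rewrite subrr /birkhoff_sum big_ord0.
rewrite /birkhoff_sum big_ord_recr -/(birkhoff_sum _ _ n x) -IH /=.
rewrite iter_skew_product /orbit_displacement /=.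
(* Writing [s_n] as the image of its lift [gamma n] makes [displacementE] applicable, and the sum
   telescopes. *)
rewrite -[X in displacement X _](covering_angle (random_orbit theta f x.1 x.2)).
by rewrite -displacementE -/gamma [RHS]addrC addrA subrK.
Qed.

End skew_product.


Theorem theorem3p1 (R : realType) (d : measure_display)
    (Omega : measurableType d) (P : probability Omega R)
    (theta : Omega -> Omega)
    (theta_preserving : measure_preserving P theta)
    (theta_ergodic : ergodic P theta)
    (f : Omega -> Hplus R) (f_measurable : measurable_fun setT f)
    (mu : probability (Omega * circle R)%type R)
    (mu_marginal : forall A : set Omega, measurable A ->
       mu (A `*` [set: circle R]) = P A)
    (mu_invariant : invariant_measure mu (skew_product theta f))
    (mu_ergodic : ergodic mu (skew_product theta f)) :
  {ae mu, forall x : Omega * circle R,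
    let gamma := angle (random_orbit theta f x.1 x.2) in
    cvgn (fun n : nat => (gamma n - gamma 0%N) / n%:R)}.
Proof.
have mp : measure_preserving mu (skew_product theta f).
  by split => //; exact: measurable_skew_product theta_preserving.1 f_measurable.
have bound x : `|orbit_displacement f x| <= 1.
  have := displacement_bounds x.2 (f x.1 x.2).
  by rewrite -/(orbit_displacement f x) ler_norml; lra.
apply: filterS (birkhoff_ergodic mp mu_ergodic
  (measurable_orbit_displacement f_measurable) bound) => x lim /=.
under eq_fun do rewrite angle_birkhoff_sum.
exact: cvgP lim.
Qed.
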